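(* The integer $8$ is the smallest positive integer $n$ such that every permutation $p\in S_n$ has a $3$-additive subsequence of length four.
   Context: $S_n$ denotes the set of permutations of $\{1,2,\ldots,n\}$ written in one-line notation $p=(p_1,p_2,\ldots,p_n)$. A subsequence of $p$ of length $k$ is a sequence $(p_{i_1},\ldots,p_{i_k})$ with $i_1<\cdots<i_k$. A sequence $(a_1,a_2,\ldots,a_k)$ of positive integers is $\ell$-additive if $a_1+a_2+\cdots+a_k=\ell a_1$ or $a_1+a_2+\cdots+a_k=\ell a_k$. *)

(* Defs.v *)
From mathcomp Require Import all_boot all_fingroup.

Set Implicit Arguments.
Unset Strict Implicit.
Unset Printing Implicit Defensive.

(* 'S_n permutes {0, ..., n-1}; positions and values are shifted by one to get
   a word in the letters {1, ..., n}. *)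
Definition one_line (n : nat) (p : 'S_n) : seq nat :=
  [seq (p i).+1 | i <- enum 'I_n].

(* The default 0 is only reached on the empty sequence. *)
Definition additive (l : nat) (s : seq nat) : Prop :=
  sumn s = l * head 0 s \/ sumn s = l * last 0 s.

Definition has_additive_subseq (l k n : nat) (p : 'S_n) : Prop :=
  exists s : seq nat, [/\ subseq s (one_line p), size s = k & additive l s].

Definition is_least_positive (P : nat -> Prop) (n : nat) : Prop :=
  [/\ 0 < n, P n & forall m : nat, 0 < m -> P m -> n <= m].

(* Main.v *)
Require Import Defs.
From mathcomp Require Import all_boot all_fingroup.

(** A word has a [3]-additive subsequence of length four exactly when one of its
    letters [a] has, among the letters on one side of it, three whose sum is
    [2a]: [a] is the first or the last term of the subsequence, and the other
    three terms add up to [3a - a].  Call such a letter [a] flanked.  In a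
    permutation of [{1, ..., n}], whether [a] is flanked depends only on the set
    of letters to its left, since the letters to its right are the remaining
    ones.

    Hence a permutation without the pattern can be grown from left to right, and
    a prefix can be abandoned as soon as its newest letter is flanked, whatever
    comes later.  For [n = 8] the word must start with 1, 2 or 3, because
    [8 = 1+2+5], [10 = 1+2+7], [12 = 1+3+8], [14 = 1+5+8] and [16 = 3+6+7]; fewer
    than a thousand prefixes survive in all, and none has length eight.  The lemma
    [flank_tree_sound] turns this finite search into a statement on words.

    For [n <= 7] the word [1 2 4 5 6 7 3], with the letters exceeding [n] deleted,
    avoids the pattern: deleting letters creates no new subsequences, so only the
    word of length seven has to be examined. *)

Set Implicit Arguments.
Unset Strict Implicit.
Unset Printing Implicit Defensive.

Fixpoint has_ksum (k t : nat) (s : seq nat) : bool :=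
  match k, s with
  | 0, _ => t == 0
  | _.+1, [::] => false
  | k'.+1, x :: s' => (x <= t) && has_ksum k' (t - x) s' || has_ksum k t s'
  end.

Lemma has_ksumP k t s :
  reflect (exists s', [/\ subseq s' s, size s' = k & sumn s' = t])
          (has_ksum k t s).
Proof.
elim: s k t => [|x s IHs] [|k] t /=.
- apply: (iffP eqP) => [->|[s' [_ /size0nil-> <-]]] //; by exists [::].
- by apply: (iffP idP) => // -[s' [/eqP-> ]].
- apply: (iffP eqP) => [->|[s' [_ /size0nil-> <-]]] //; by exists [::].
apply: (iffP orP) => [[/andP[le_xt /IHs[s' [ss' sz sum]]] | /IHs[s' [ss' sz sum]]]
                     | [s' [ss' sz sum]]].
- by exists (x :: s'); rewrite /= eqxx sz sum subnKC.
- by exists s'; split=> //; apply: subseq_trans ss' (subseq_cons _ _).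
case: s' ss' sz sum => // y s' /=.
case: eqP => [-> ss' [sz] <-|_ ss' sz sum].
  by left; rewrite leq_addr addKn; apply/IHs; exists s'.
by right; apply/IHs; exists (y :: s').
Qed.

Lemma perm_has_ksum k t s1 s2 :
  perm_eq s1 s2 -> has_ksum k t s1 = has_ksum k t s2.
Proof.
(* By symmetry it suffices to move a choice of entries from one word to the other. *)
have transfer u v : perm_eq u v -> has_ksum k t u -> has_ksum k t v.
  move=> uv /has_ksumP[s [ssu sz sum]]; apply/has_ksumP.
  have /count_subseqP[s' ss'v ss'] x : count_mem x s <= count_mem x v.
    by rewrite -(seq.permP uv); apply: leq_count_subseq.
  by exists s'; rewrite -(perm_size ss') -(perm_sumn ss').
move=> s12; apply/idP/idP; apply: transfer => //; by rewrite perm_sym.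
Qed.

Lemma subseq_cons_split (T : eqType) (a : T) s w :
  subseq (a :: s) w -> exists u v, w = u ++ a :: v /\ subseq s v.
Proof.
elim: w => [|x w IHw] //=; case: eqP => [->|_] ss; first by exists [::], w.
by have [u [v [-> ?]]] := IHw ss; exists (x :: u), v.
Qed.

Lemma subseq_rcons_split (T : eqType) (a : T) s w :
  subseq (rcons s a) w -> exists u v, w = u ++ a :: v /\ subseq s u.
Proof.
rewrite -subseq_rev rev_rcons => /subseq_cons_split[u [v [def_w ss]]].
exists (rev v), (rev u); split; last by rewrite -subseq_rev revK.
by rewrite -[w]revK def_w rev_cat rev_cons cat_rcons.
Qed.

Definition flanked (l k : nat) (u : seq nat) (a : nat) (v : seq nat) : bool :=
  has_ksum k (l * a) u || has_ksum k (l * a) v.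

(** The prefix [u] is only an accumulator, which lets the letters of [v] see what
    precedes them when [v] is the part of a word still to be read. *)
Fixpoint has_flanked (l k : nat) (u v : seq nat) : bool :=
  if v is a :: v' then flanked l k u a v' || has_flanked l k (rcons u a) v'
  else false.

Lemma has_flankedP l k u v :
  reflect (exists v1 a v2, v = v1 ++ a :: v2 /\ flanked l k (u ++ v1) a v2)
          (has_flanked l k u v).
Proof.
elim: v u => [|b v IHv] u /=; first by constructor; case=> -[|x v1] [a [v2 []]].
apply: (iffP orP) => [[flb | /IHv[v1 [a [v2 [-> fla]]]]] | ].
- by exists [::], b, v; rewrite cats0.
- by exists (b :: v1), a, v2; rewrite -(cat_rcons b u).
case=> [[|c v1] [a [v2 [/= [<- def_v]]]]].
  by rewrite cats0 -def_v; left.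
by rewrite -(cat_rcons b u) => fla; right; apply/IHv; exists v1, a, v2.
Qed.

(** The distinguished end [a] of an additive subsequence contributes one of the
    [l.+1] copies of [a], so the other terms, all on the same side of [a], sum to
    [l * a]; conversely [a] can be attached in front of or behind such terms. *)
Lemma additive_subseqP l k w :
  reflect (exists s, [/\ subseq s w, size s = k.+1 & additive l.+1 s])
          (has_flanked l k [::] w).
Proof.
apply: (iffP (has_flankedP _ _ _ _)) => /=.
  case=> [u [a [v [-> /orP[] /has_ksumP[s [ss sz sum]]]]]].
    exists (rcons s a); rewrite size_rcons sz; split=> //.
      by rewrite -cats1; apply: cat_subseq ss _; rewrite sub1seq mem_head.
    by right; rewrite sumn_rcons sum last_rcons mulSn addnC.
  exists (a :: s); rewrite /= sz; split=> //; last by left; rewrite /= sum mulSn.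
  by apply: (@cat_subseq _ [::] (a :: s)); rewrite ?sub0seq //= eqxx.
case=> s [ss sz [] sum].
  case: s ss sz sum => // a s /subseq_cons_split[u [v [-> ss]]] /= [sz].
  rewrite mulSn => /addnI sum; exists u, a, v; split=> //.
  by apply/orP; right; apply/has_ksumP; exists s.
case/lastP: s ss sz sum => // s a /subseq_rcons_split[u [v [-> ss]]].
rewrite size_rcons last_rcons sumn_rcons => -[sz].
rewrite mulSn addnC => /addnI sum; exists u, a, v; split=> //.
by apply/orP; left; apply/has_ksumP; exists s.
Qed.

(** Every way of appending the [n] letters of [r] to the prefix [u] flanks one of
    them.  The value [false] at depth [0] means that a complete word has been
    reached without flanking a letter. *)
Fixpoint flank_tree (l k n : nat) (u r : seq nat) : bool :=
  if n is n'.+1 then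
    all (fun a => flanked l k u a (rem a r)
                  || flank_tree l k n' (rcons u a) (rem a r)) r
  else false.

(** The search knows only which letters [r] remain, not their order; that is
    enough because sums are insensitive to it. *)
Lemma flank_tree_sound l k n u r v :
  size r = n -> perm_eq r v -> flank_tree l k n u r -> has_flanked l k u v.
Proof.
elim: n u r v => [|n IHn] u r [|a v] //= sz rv.
  by move: sz; rewrite (perm_size rv).
have ra : a \in r by rewrite (perm_mem rv) mem_head.
have rv' : perm_eq (rem a r) v.
  by rewrite -(perm_cons a) -(permPl (perm_to_rem ra)).
move=> /allP/(_ a ra) /orP[fla | tree]; apply/orP.
  by left; move: fla; rewrite /flanked (perm_has_ksum _ _ rv').
by right; apply: IHn tree; rewrite ?size_rem ?sz.
Qed.

Lemma perm_one_line n (p : 'S_n) : perm_eq (iota 1 n) (one_line p).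
Proof.
rewrite perm_sym; apply: uniq_perm; rewrite ?iota_uniq //.
  rewrite map_inj_uniq ?enum_uniq // => i j [] /val_inj; exact: perm_inj.
move=> x; rewrite mem_iota; apply/mapP/andP => [[i _ ->] | [x_gt0 x_le]].
  by rewrite add1n; split=> //; apply: ltn_ord.
case: x x_gt0 x_le => // x _; rewrite add1n ltnS => ltxn.
by exists (p^-1 (Ordinal ltxn))%g; rewrite ?mem_enum // permKV.
Qed.

Lemma one_line_surj n w :
  perm_eq w (iota 1 n) -> exists p : 'S_n, one_line p = w.
Proof.
move=> wn; have sz : size w = n by rewrite (perm_size wn) size_iota.
have w_bounds (i : 'I_n) : 0 < nth 0 w i <= n.
  by rewrite -[_ <= n]ltnS -mem_iota -(perm_mem wn) mem_nth ?sz.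
pose f (i : 'I_n) : 'I_n := insubd i (nth 0 w i).-1.
have fE i : (f i).+1 = nth 0 w i.
  have /andP[w_gt0 w_le] := w_bounds i.
  by rewrite val_insubd prednK // w_le prednK.
have f_inj : injective f.
  move=> i j /(congr1 (fun x : 'I_n => x.+1)); rewrite !fE => /eqP.
  rewrite nth_uniq ?sz //; first by move/eqP/val_inj.
  by rewrite (perm_uniq wn) iota_uniq.
exists (perm f_inj); rewrite /one_line.
under eq_map => i do rewrite permE fE.
by rewrite (map_comp (nth 0 w) val) val_enum_ord -sz -/(mkseq _ _) mkseq_nth.
Qed.

Theorem proposition4p2 :
  is_least_positive (fun n : nat => forall p : 'S_n, has_additive_subseq 3 4 p) 8.
Proof.
split=> // [p | m m_gt0 has_m].
  apply/(additive_subseqP 2 3); apply: flank_tree_sound (perm_one_line p) _.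
    by rewrite size_iota.
  by vm_compute.
rewrite leqNgt; apply/negP => m_lt8.
pose w := [:: 1; 2; 4; 5; 6; 7; 3].
have w_avoids : ~~ has_flanked 2 3 [::] w by vm_compute.
have /one_line_surj[p p_line] : perm_eq [seq x <- w | x <= m] (iota 1 m).
  by move: m_lt8 {has_m}; do 8 case: m m_gt0 => [|m] m_gt0 //.
have [s [ss sz adds]] := has_m p; rewrite p_line in ss.
case/(additive_subseqP 2 3): w_avoids; exists s; split=> //.
exact: subseq_trans ss (filter_subseq _ _).
Qed.
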